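(* For every $\mathrm{PDL}_{\mathrm{REwLA+}}$ formula $\varphi$ (over $\mathbb{A},\mathbb{P}$), $\varphi$ is valid on $\mathrm{GREL}_{\mathrm{finlin}}$ if and only if $\varphi$ is derivable in the Hilbert system $\mathcal{H}$ described in the context.
   Context: Fix disjoint sets $\mathbb{A}$ (term variables) and $\mathbb{P}$ (formula variables). A generalized structure $M$ consists of a nonempty set $|M|$, a binary relation $U^M\subseteq |M|^2$, a binary relation $a^M\subseteq U^M$ for each $a\in\mathbb{A}$, and a set $p^M\subseteq |M|$ for each $p\in\mathbb{P}$. $\mathrm{GREL}_{\mathrm{finlin}}$ is the class of generalized structures with $|M|$ finite and $U^M$ a (reflexive) linear order on $|M|$; $\mathrm{REL}$ is the class of generalized structures with $U^M=|M|^2$. Operations on binary relations $R,S$ on a set $X$: $R;S$ composition, $R+S=R\cup S$, $R^+$ transitive closure, $R^{\mathtt a}=\{(x,x): x\in X,\ \neg\exists y\,(x,y)\in R\}$ (antidomain), $R^{\cap_{\mathrm{id}}}=R\cap\Delta_X$, $R^{\cap_{\overline{\mathrm{id}}}}=R\setminus\Delta_X$ where $\Delta_X=\{(x,x):x\in X\}$. $\mathrm{PDL}_{\mathrm{REwLA+}}$ formulas and terms are defined mutually: $\varphi::= p\ (p\in\mathbb P)\mid \varphi\to\varphi\mid \mathtt F\mid [t]\varphi$ and $t::= a\ (a\in\mathbb A)\mid t;t\mid t+t\mid t^+\mid t^{\mathtt a}\mid t^{\cap_{\mathrm{id}}}\mid t^{\cap_{\overline{\mathrm{id}}}}\mid \varphi?$.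 Abbreviations: $\neg\varphi=\varphi\to\mathtt F$, $\vee,\wedge,\leftrightarrow$ as usual, $\mathtt T=\neg\mathtt F$, $\langle t\rangle\varphi=\neg[t]\neg\varphi$, $tu$ for $t;u$. Semantics in a generalized structure $M$: $[\![p]\!]=p^M$, $[\![\varphi\to\psi]\!]=(|M|\setminus[\![\varphi]\!])\cup[\![\psi]\!]$, $[\![\mathtt F]\!]=\emptyset$, $[\![[t]\varphi]\!]=\{x:\forall y\,((x,y)\in[\![t]\!]\Rightarrow y\in[\![\varphi]\!])\}$, $[\![a]\!]=a^M$, $[\![\varphi?]\!]=\{(x,x):x\in[\![\varphi]\!]\}$, and the other term operators are the relation operations above. A formula is valid on a class $\mathcal C$ if $[\![\varphi]\!]_M=|M|$ for every $M\in\mathcal C$. PDL formulas are the $\mathrm{PDL}_{\mathrm{REwLA+}}$ formulas not using $\cdot^{\mathtt a},\cdot^{\cap_{\mathrm{id}}},\cdot^{\cap_{\overline{\mathrm{id}}}}$. The system $\mathcal H$ has rules: from $\varphi$ and $\varphi\to\psi$ infer $\psi$; from $\varphi$ infer $[t]\varphi$. Its axioms (for all terms $t,u$ and formulas $\varphi,\psi$): (PDL) every substitution instance (replacing term variables by $\mathrm{PDL}_{\mathrm{REwLA+}}$ terms and formula variables by $\mathrm{PDL}_{\mathrm{REwLA+}}$ formulas) of a PDL formula valid on $\mathrm{REL}$; $[t^{\mathtt a}]\varphi\leftrightarrow[[t]\mathtt F?]\varphi$; $[t^{\cap_{\mathrm{id}}}]\varphi\leftrightarrow[\langle t^{\cap_{\mathrm{id}}}\rangle\mathtt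 T?]\varphi$; $[(tu)^{\cap_{\mathrm{id}}}]\varphi\leftrightarrow[t^{\cap_{\mathrm{id}}}u^{\cap_{\mathrm{id}}}]\varphi$; $[(t+u)^{\cap_{\mathrm{id}}}]\varphi\leftrightarrow[t^{\cap_{\mathrm{id}}}+u^{\cap_{\mathrm{id}}}]\varphi$; $[(t^+)^{\cap_{\mathrm{id}}}]\varphi\leftrightarrow[t^{\cap_{\mathrm{id}}}]\varphi$; $[(t^{\mathtt a})^{\cap_{\mathrm{id}}}]\varphi\leftrightarrow[t^{\mathtt a}]\varphi$; $[(t^{\cap_{\mathrm{id}}})^{\cap_{\mathrm{id}}}]\varphi\leftrightarrow[t^{\cap_{\mathrm{id}}}]\varphi$; $[(t^{\cap_{\overline{\mathrm{id}}}})^{\cap_{\mathrm{id}}}]\varphi\leftrightarrow\mathtt T$; $[(\psi?)^{\cap_{\mathrm{id}}}]\varphi\leftrightarrow[\psi?]\varphi$; $[t]\varphi\leftrightarrow[t^{\cap_{\mathrm{id}}}+t^{\cap_{\overline{\mathrm{id}}}}]\varphi$; $[(tu)^{\cap_{\overline{\mathrm{id}}}}]\varphi\leftrightarrow[t^{\cap_{\overline{\mathrm{id}}}}u^{\cap_{\mathrm{id}}}+t^{\cap_{\mathrm{id}}}u^{\cap_{\overline{\mathrm{id}}}}+t^{\cap_{\overline{\mathrm{id}}}}u^{\cap_{\overline{\mathrm{id}}}}]\varphi$; $[(t+u)^{\cap_{\overline{\mathrm{id}}}}]\varphi\leftrightarrow[t^{\cap_{\overline{\mathrm{id}}}}+u^{\cap_{\overline{\mathrm{id}}}}]\varphi$;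 $[(t^+)^{\cap_{\overline{\mathrm{id}}}}]\varphi\leftrightarrow[(t^{\cap_{\overline{\mathrm{id}}}})^+]\varphi$; $[(t^{\mathtt a})^{\cap_{\overline{\mathrm{id}}}}]\varphi\leftrightarrow\mathtt T$; $[(t^{\cap_{\mathrm{id}}})^{\cap_{\overline{\mathrm{id}}}}]\varphi\leftrightarrow\mathtt T$; $[(t^{\cap_{\overline{\mathrm{id}}}})^{\cap_{\overline{\mathrm{id}}}}]\varphi\leftrightarrow[t^{\cap_{\overline{\mathrm{id}}}}]\varphi$; $[(\psi?)^{\cap_{\overline{\mathrm{id}}}}]\varphi\leftrightarrow\mathtt T$; and (restricted Löb) $[(t^{\cap_{\overline{\mathrm{id}}}})^+]([(t^{\cap_{\overline{\mathrm{id}}}})^+]\varphi\to\varphi)\to[(t^{\cap_{\overline{\mathrm{id}}}})^+]\varphi$.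
   Formalization: In axiom (PDL), the PDL formula valid on REL may use any sets of schematic variables, not only those of 𝔸 and ℙ; for infinite 𝔸, ℙ the instances are the same, while for 𝔸=ℙ=∅ the literal system cannot derive χ→χ with χ=[t^a]F. *)

(* Defs.v *)
From Stdlib Require Export Relations FinFun.

Set Implicit Arguments.

(* Term variables and formula variables are two separate types, so the two
   sets of variables are disjoint by construction. *)
Inductive fm (A P : Type) : Type :=
| FVar (p : P)
| FImp (phi psi : fm A P)
| FFalse
| FBox (t : tm A P) (phi : fm A P)
with tm (A P : Type) : Type :=
| TVar (a : A)
| TSeq (t u : tm A P)
| TSum (t u : tm A P)
| TPlus (t : tm A P)
| TAnti (t : tm A P)
| TId (t : tm A P)
| TNid (t : tm A P)
| TTest (phi : fm A P).

Arguments FVar {A P} p.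
Arguments FImp {A P} phi psi.
Arguments FFalse {A P}.
Arguments FBox {A P} t phi.
Arguments TVar {A P} a.
Arguments TSeq {A P} t u.
Arguments TSum {A P} t u.
Arguments TPlus {A P} t.
Arguments TAnti {A P} t.
Arguments TId {A P} t.
Arguments TNid {A P} t.
Arguments TTest {A P} phi.

Section Abbreviations.
Variables A P : Type.
Definition FNot (phi : fm A P) : fm A P := FImp phi FFalse.
Definition FOr (phi psi : fm A P) : fm A P := FImp (FNot phi) psi.
Definition FAnd (phi psi : fm A P) : fm A P := FNot (FOr (FNot phi) (FNot psi)).
Definition FIff (phi psi : fm A P) : fm A P := FAnd (FImp phi psi) (FImp psi phi).
Definition FTrue : fm A P := FNot FFalse.
Definition FDia (t : tm A P) (phi : fm A P) : fm A P := FNot (FBox t (FNot phi)).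
End Abbreviations.
Arguments FTrue {A P}.

Record gstruct (A P : Type) : Type := GStruct {
  carrier : Type;
  carrier_nonempty : inhabited carrier;
  univ : relation carrier;
  tval : A -> relation carrier;
  tval_univ : forall a : A, inclusion carrier (tval a) univ;
  fval : P -> carrier -> Prop
}.

Section Operations.
Variable X : Type.
Implicit Types R S : relation X.
Definition rcomp R S : relation X := fun x z => exists y, R x y /\ S y z.
Definition ranti R : relation X := fun x y => x = y /\ ~ (exists z, R x z).
Definition rcap_id R : relation X := fun x y => R x y /\ x = y.
Definition rcap_nid R : relation X := fun x y => R x y /\ x <> y.
End Operations.

Section Semantics.
Variables (A P : Type) (M : gstruct A P).

Fixpoint fsem (phi : fm A P) : carrier M -> Prop :=
  match phi with
  | FVar p => fval M p
  | FImp psi chi => fun x => ~ fsem psi x \/ fsem chi x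
  | FFalse => fun _ => False
  | FBox t psi => fun x => forall y, tsem t x y -> fsem psi y
  end
with tsem (t : tm A P) : relation (carrier M) :=
  match t with
  | TVar a => tval M a
  | TSeq u v => rcomp (tsem u) (tsem v)
  | TSum u v => union (carrier M) (tsem u) (tsem v)
  | TPlus u => clos_trans (carrier M) (tsem u)
  | TAnti u => ranti (tsem u)
  | TId u => rcap_id (tsem u)
  | TNid u => rcap_nid (tsem u)
  | TTest phi => fun x y => x = y /\ fsem phi x
  end.
End Semantics.

Definition valid_on (A P : Type) (C : gstruct A P -> Prop) (phi : fm A P) : Prop :=
  forall M : gstruct A P, C M -> forall x : carrier M, fsem M phi x.

Definition GREL_finlin (A P : Type) (M : gstruct A P) : Prop :=
  Finite (carrier M) /\
  order (carrier M) (univ M) /\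
  (forall x y : carrier M, univ M x y \/ univ M y x).

Definition REL (A P : Type) (M : gstruct A P) : Prop :=
  forall x y : carrier M, univ M x y.

Fixpoint is_pdl_fm (A P : Type) (phi : fm A P) : Prop :=
  match phi with
  | FVar _ | FFalse => True
  | FImp psi chi => is_pdl_fm psi /\ is_pdl_fm chi
  | FBox t psi => is_pdl_tm t /\ is_pdl_fm psi
  end
with is_pdl_tm (A P : Type) (t : tm A P) : Prop :=
  match t with
  | TVar _ => True
  | TSeq u v | TSum u v => is_pdl_tm u /\ is_pdl_tm v
  | TPlus u => is_pdl_tm u
  | TAnti _ | TId _ | TNid _ => False
  | TTest phi => is_pdl_fm phi
  end.

Section Substitution.
Variables (A' P' A P : Type) (sa : A' -> tm A P) (sp : P' -> fm A P).

Fixpoint fsubst (phi : fm A' P') : fm A P :=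
  match phi with
  | FVar p => sp p
  | FImp psi chi => FImp (fsubst psi) (fsubst chi)
  | FFalse => FFalse
  | FBox t psi => FBox (tsubst t) (fsubst psi)
  end
with tsubst (t : tm A' P') : tm A P :=
  match t with
  | TVar a => sa a
  | TSeq u v => TSeq (tsubst u) (tsubst v)
  | TSum u v => TSum (tsubst u) (tsubst v)
  | TPlus u => TPlus (tsubst u)
  | TAnti u => TAnti (tsubst u)
  | TId u => TId (tsubst u)
  | TNid u => TNid (tsubst u)
  | TTest phi => TTest (fsubst phi)
  end.
End Substitution.

(* In [H_PDL] the substituted PDL formula [chi] may be written over any sets
   [A'], [P'] of schematic variables, [A' := A] and [P' := P] included.  When
   [A] and [P] are infinite, [A' := A] and [P' := P] already give all the
   instances, since [chi] has finitely many variables and can be renamed.  With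
   too few variables the schema over [A] and [P] alone would be degenerate: for
   [A] and [P] empty it would have no instance containing [TAnti], [TId] or
   [TNid], and even [FImp psi psi] with [psi := FBox (TAnti t) FFalse] would
   not be derivable. *)
Inductive derivable (A P : Type) : fm A P -> Prop :=
| H_MP (phi psi : fm A P) :
    derivable phi -> derivable (FImp phi psi) -> derivable psi
| H_Nec (t : tm A P) (phi : fm A P) :
    derivable phi -> derivable (FBox t phi)
| H_PDL (A' P' : Type) (chi : fm A' P') (sa : A' -> tm A P) (sp : P' -> fm A P) :
    is_pdl_fm chi -> valid_on (@REL A' P') chi -> derivable (fsubst sa sp chi)
| H_anti (t : tm A P) (phi : fm A P) :
    derivable (FIff (FBox (TAnti t) phi) (FBox (TTest (FBox t FFalse)) phi))
| H_id (t : tm A P) (phi : fm A P) :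
    derivable (FIff (FBox (TId t) phi)
                    (FBox (TTest (FDia (TId t) FTrue)) phi))
| H_id_seq (t u : tm A P) (phi : fm A P) :
    derivable (FIff (FBox (TId (TSeq t u)) phi)
                    (FBox (TSeq (TId t) (TId u)) phi))
| H_id_sum (t u : tm A P) (phi : fm A P) :
    derivable (FIff (FBox (TId (TSum t u)) phi)
                    (FBox (TSum (TId t) (TId u)) phi))
| H_id_plus (t : tm A P) (phi : fm A P) :
    derivable (FIff (FBox (TId (TPlus t)) phi) (FBox (TId t) phi))
| H_id_anti (t : tm A P) (phi : fm A P) :
    derivable (FIff (FBox (TId (TAnti t)) phi) (FBox (TAnti t) phi))
| H_id_id (t : tm A P) (phi : fm A P) :
    derivable (FIff (FBox (TId (TId t)) phi) (FBox (TId t) phi))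
| H_id_nid (t : tm A P) (phi : fm A P) :
    derivable (FIff (FBox (TId (TNid t)) phi) FTrue)
| H_id_test (psi phi : fm A P) :
    derivable (FIff (FBox (TId (TTest psi)) phi) (FBox (TTest psi) phi))
| H_split (t : tm A P) (phi : fm A P) :
    derivable (FIff (FBox t phi) (FBox (TSum (TId t) (TNid t)) phi))
| H_nid_seq (t u : tm A P) (phi : fm A P) :
    derivable (FIff (FBox (TNid (TSeq t u)) phi)
                    (FBox (TSum (TSum (TSeq (TNid t) (TId u))
                                      (TSeq (TId t) (TNid u)))
                                (TSeq (TNid t) (TNid u))) phi))
| H_nid_sum (t u : tm A P) (phi : fm A P) :
    derivable (FIff (FBox (TNid (TSum t u)) phi)
                    (FBox (TSum (TNid t) (TNid u)) phi))
| H_nid_plus (t : tm A P) (phi : fm A P) :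
    derivable (FIff (FBox (TNid (TPlus t)) phi) (FBox (TPlus (TNid t)) phi))
| H_nid_anti (t : tm A P) (phi : fm A P) :
    derivable (FIff (FBox (TNid (TAnti t)) phi) FTrue)
| H_nid_id (t : tm A P) (phi : fm A P) :
    derivable (FIff (FBox (TNid (TId t)) phi) FTrue)
| H_nid_nid (t : tm A P) (phi : fm A P) :
    derivable (FIff (FBox (TNid (TNid t)) phi) (FBox (TNid t) phi))
| H_nid_test (psi phi : fm A P) :
    derivable (FIff (FBox (TNid (TTest psi)) phi) FTrue)
| H_Loeb (t : tm A P) (phi : fm A P) :
    derivable (FImp (FBox (TPlus (TNid t)) (FImp (FBox (TPlus (TNid t)) phi) phi))
                    (FBox (TPlus (TNid t)) phi)).

(* Main.v *)
Require Import Defs.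
From Stdlib Require Import Classical ClassicalEpsilon.
From mathcomp Require Import all_boot.

Set Implicit Arguments.
Unset Strict Implicit.
Unset Printing Implicit Defensive.

(** Soundness: on a finite linear order every term denotes a subrelation of
    the order, so antisymmetry forces a loop of [t; u] to be a loop of both [t]
    and [u], and the strict part of a term is conversely well-founded, which
    is Löb's axiom.

    Completeness: the axioms determine the identity part of [t] by the formula
    [loops t] and unfold the boxes of its strict part along the structure of
    [t].  The worlds of the countermodel are pairs [(X, E)], where [X] is a
    truth assignment to a finite closure set and [E] a set of assignments that
    never occur strictly later.  By Löb's axiom a consistent assignment has a
    last occurrence, so each diamond of an atom is witnessed by an assignment
    which may at once be added to [E].  Hence [E] grows strictly along every
    non-identity step: the model is acyclic, any linear extension serves as
    the universe relation, and since all iterations stop, the fixpoint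
    unfolding of [t^+] suffices for the truth lemma. *)

(* Mutual induction on formulas and terms, and classical reading of the connectives *)
Scheme fm_tm_ind := Induction for fm Sort Prop
  with tm_fm_ind := Induction for tm Sort Prop.
Combined Scheme fm_tm_mutind from fm_tm_ind, tm_fm_ind.

Lemma fsem_imp (A P : Type) (M : gstruct A P) (f g : fm A P) x :
  (fsem M f x -> fsem M g x) -> fsem M (FImp f g) x.
Proof. by move=> H /=; tauto. Qed.

Lemma fsem_iff (A P : Type) (M : gstruct A P) (f g : fm A P) x :
  (fsem M f x <-> fsem M g x) -> fsem M (FIff f g) x.
Proof. by rewrite /=; tauto. Qed.

Lemma fsem_and (A P : Type) (M : gstruct A P) (f g : fm A P) x :
  fsem M (FAnd f g) x <-> fsem M f x /\ fsem M g x.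
Proof. by rewrite /=; tauto. Qed.

(** * Soundness, beginning with substitution instances of PDL formulas *)

Section Soundness.
Variables A P : Type.

Section SubstitutionLemma.
Variables (A' P' : Type) (sa : A' -> tm A P) (sp : P' -> fm A P).

(** Each schematic variable denotes what is substituted for it. The total universe relation places
    the structure in [REL], so a schematic validity transfers to its instances. *)
Definition pullback (M : gstruct A P) : gstruct A' P' :=
  @GStruct A' P' (carrier M) (carrier_nonempty M) (fun _ _ => True)
    (fun a => tsem M (sa a)) (fun _ _ _ _ => I) (fun p => fsem M (sp p)).

Lemma sem_subst (M : gstruct A P) :
  (forall phi x, fsem M (fsubst sa sp phi) x <-> fsem (pullback M) phi x) /\
  (forall t x y, tsem M (tsubst sa sp t) x y <-> tsem (pullback M) t x y).
Proof.
apply: fm_tm_mutind => //=.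
- by move=> phi IH1 psi IH2 x; rewrite IH1 IH2.
- by move=> t IHt phi IH x; split=> H y /IHt /H /IH.
- move=> t IHt u IHu x y.
  by split=> -[z [/IHt ? /IHu ?]]; exists z.
- by move=> t IHt u IHu x y; split=> -[/IHt|/IHu]; [left|right|left|right].
- move=> t IHt x y; split; elim=> [u v /IHt|u v w _ H1 _ H2].
  + exact: t_step.
  + exact: t_trans H1 H2.
  + exact: t_step.
  + exact: t_trans H1 H2.
- move=> t IHt x y.
  by split=> -[e H]; split=> // -[z /IHt Hz]; apply: H; exists z.
- by move=> t IHt x y; split=> -[/IHt].
- by move=> t IHt x y; split=> -[/IHt].
- by move=> phi IH x y; split=> -[e /IH].
Qed.

End SubstitutionLemma.

(** * Terms interpreted over a finite linear order *)

Section FiniteOrder.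
Variable M : gstruct A P.
Hypothesis HM : GREL_finlin M.
Let X := carrier M.
Let U := univ M.

Let U_refl x : U x x. Proof. by case: HM => _ [[r _ _] _]; apply: r. Qed.
Let U_trans x y z : U x y -> U y z -> U x z.
Proof. by case: HM => _ [[_ r _] _]; apply: r. Qed.
Let U_anti x y : U x y -> U y x -> x = y.
Proof. by case: HM => _ [[_ _ r] _]; apply: r. Qed.

Lemma tsem_univ t x y : tsem M t x y -> U x y.
Proof.
elim: t x y => //=.
- by move=> a x y; apply: tval_univ.
- by move=> t IHt u IHu x y [z [/IHt ? /IHu]]; apply: U_trans.
- by move=> t IHt u IHu x y [/IHt|/IHu].
- move=> t IHt x y; elim=> [? ? /IHt//|? ? ? _ H1 _ H2].
  exact: U_trans H1 H2.
- by move=> t _ x y [-> _].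
- by move=> t IHt x y [/IHt].
- by move=> t IHt x y [/IHt].
- by move=> phi x y [-> _].
Qed.

Lemma tsem_seq_id t u x y :
  tsem M t x y -> tsem M u y x -> y = x.
Proof. by move=> /tsem_univ h1 /tsem_univ h2; apply: U_anti. Qed.

(** The first step of a cycle goes up in the order and the rest comes back, so by antisymmetry that
    first step is already a loop. *)
Lemma tsem_plus_id t x : tsem M (TPlus t) x x -> tsem M t x x.
Proof.
move=> /= /clos_trans_t1n_iff h.
inversion h as [?|y ? hxy hyx]; subst => //.
have e : y = x.
  by apply: (tsem_seq_id hxy (u := TPlus t)); apply/clos_trans_t1n_iff.
by move: hxy; rewrite e.
Qed.

Lemma nid_plus_irrefl t x : ~ clos_trans X (rcap_nid (tsem M t)) x x.
Proof.
move=> /clos_trans_t1n_iff h.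
inversion h as [y [hxy nxy]|y ? [hxy nxy] hyx]; subst => //.
apply: nxy; apply/esym.
by apply: (tsem_seq_id hxy (u := TPlus (TNid t))); apply/clos_trans_t1n_iff.
Qed.

(** Finiteness provides a counterexample to [Q] none of whose [R]-successors is one, and the
    induction hypothesis on [Q] excludes it. *)
Lemma strict_loeb (R : relation X) (Q : X -> Prop) :
  (forall x y z, R x y -> R y z -> R x z) -> (forall x, ~ R x x) ->
  (forall x, (forall y, R x y -> Q y) -> Q x) -> forall x, Q x.
Proof.
move=> tr irr step x; apply: NNPP => nq.
have [[l Hl] _] := HM.
(* Scanning an enumeration, keep a counterexample all of whose successors seen
   so far satisfy [Q]. *)
suff: forall (l : list X) x, ~ Q x -> exists y,
    [/\ ~ Q y, x = y \/ R x y & forall z, List.In z l -> R y z -> Q z].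
  case/(_ l x nq) => y [nqy _ H]; apply: nqy; apply: step => z; apply: H.
  exact: Hl.
elim=> [|a l' IH] y nqy; first by exists y; split=> //; left.
have [y' [nq' Hy' H']] := IH y nqy.
have [[nqa Rya]|h] := classic (~ Q a /\ R y' a).
  (* The new element [a] is a later counterexample, so the scan of the tail restarts there;
     irreflexivity prevents the result from seeing [a]. *)
  have [z [nqz Hz H]] := IH a nqa.
  have Raz w : R z w -> R a w by case: Hz => [->//|h]; apply: tr h.
  exists z; split=> //.
    right; have Rya' : R y a by case: Hy' => [->//|h]; apply: tr Rya.
    by case: Hz => [<-//|h]; exact: tr h.
  by move=> w [<- /Raz/irr|w_in] //; apply: H.
exists y'; split=> // w [<- Rya|]; last exact: H'.
by apply: NNPP => nqa; apply: h.
Qed.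

End FiniteOrder.

(** * Validity of the axioms *)

Lemma fsem_box_iff (M : gstruct A P) t u (phi : fm A P) x :
  (forall x y, tsem M t x y <-> tsem M u x y) ->
  fsem M (FIff (FBox t phi) (FBox u phi)) x.
Proof.
by move=> H; apply: fsem_iff; split=> Ht y Hy; apply: Ht; apply/H.
Qed.

Lemma fsem_box_empty (M : gstruct A P) t (phi : fm A P) x :
  (forall x y, ~ tsem M t x y) -> fsem M (FIff (FBox t phi) FTrue) x.
Proof.
by move=> H; apply: fsem_iff; split=> [_|_ y /H//] /=; left.
Qed.

Lemma fsem_dia (M : gstruct A P) t (x : carrier M) :
  fsem M (FDia t FTrue) x <-> exists y, tsem M t x y.
Proof.
split=> [/= [nH|//]|[y txy]].
  by apply: NNPP => nex; apply: nH => y txy; case: nex; exists y.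
by left=> /= H; have [nT|] := H y txy; [apply: nT; left|].
Qed.

Lemma soundness (phi : fm A P) : derivable phi -> valid_on (@GREL_finlin A P) phi.
Proof.
move=> D M HM; elim: D => {phi}.
- by move=> phi psi _ H1 _ H2 x; have := H2 x => /= -[nH|//]; case: nH; apply: H1.
- by move=> t phi _ H x y _; apply: H.
- move=> A' P' chi sa sp _ H x; apply/(sem_subst sa sp M).1.
  exact: H.
- move=> t phi x; apply: fsem_box_iff => {}x y /=; split=> -[-> H]; split=> //.
  + by move=> z tz; apply: H; exists z.
  + by case=> z /H.
- move=> t phi x; apply: fsem_box_iff => {}x y; split.
  + case=> txy e; subst y; split=> //; apply/fsem_dia.
    by exists x; split.
  + case=> <- H; have [z [txz e]] := (@fsem_dia M (TId t) x).1 H.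
    by subst z.
- move=> t u phi x; apply: fsem_box_iff => {}x y /=; split.
  + case=> -[z [txz tzy]] e; subst y; have e := tsem_seq_id HM txz tzy; subst z.
    by exists x; split; split.
  + case=> z [[txz e1] [uxy e2]]; subst z y.
    by split=> //; exists x.
- move=> t u phi x; apply: fsem_box_iff => {}x y /=; split.
  + by case=> -[?|?] e; subst y; [left|right].
  + by case=> -[? e]; subst y; split=> //; [left|right].
- move=> t phi x; apply: fsem_box_iff => {}x y /=; split=> -[H e]; subst y.
  + by split=> //; apply: (tsem_plus_id HM H).
  + by split=> //; apply: t_step.
- by move=> t phi x; apply: fsem_box_iff => {}x y; split=> [[]|[e H]].
- by move=> t phi x; apply: fsem_box_iff => {}x y; split=> [[]|[]].
- by move=> t phi x; apply: fsem_box_empty => {}x y [[]].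
- by move=> psi phi x; apply: fsem_box_iff => {}x y; split=> [[]|[e H]].
- move=> t phi x; apply: fsem_box_iff => {}x y /=; split.
  + by move=> H; have [e|ne] := classic (x = y); [left|right].
  + by case=> -[].
- move=> t u phi x; apply: fsem_box_iff => {}x y /=; split.
  + case=> -[z [txz uzy]] nxy.
    have [e|nxz] := classic (x = z); have [e'|nzy] := classic (z = y); subst => //.
    * by left; right; exists z.
    * by left; left; exists y.
    * by right; exists z.
  + case=> [[]|] [z [[txz h1] [uzy h2]]]; split; try by exists z.
    * by rewrite -h2.
    * by rewrite h1.
    (* Two strict steps cannot return to their start: antisymmetry would make the first one a
       loop. *)
    * move=> e; subst y; apply: h1.
      by rewrite (tsem_seq_id HM txz uzy).
- move=> t u phi x; apply: fsem_box_iff => {}x y /=; split.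
  + by case=> -[?|?] ?; [left|right].
  + by case=> -[? ?]; split=> //; [left|right].
- move=> t phi x; apply: fsem_box_iff => {}x y /=; split.
  + case=> H; elim: H => [{}x {}y txy nxy|{}x y' z _ H1 _ H2 nxz].
      exact: t_step.
    have [e|n1] := classic (x = y'); have [e'|n2] := classic (y' = z); subst => //.
    * exact: H2.
    * exact: H1.
    * by apply: t_trans (H1 n1) (H2 n2).
  + move=> H; split; last by move=> e; subst y; apply: (nid_plus_irrefl HM H).
    elim: H => [? ? []|? ? ? _ H1 _ H2]; [by left|exact: t_trans H1 H2].
- by move=> t phi x; apply: fsem_box_empty => {}x y [[-> _]].
- by move=> t phi x; apply: fsem_box_empty => {}x y [[_ ->]].
- by move=> t phi x; apply: fsem_box_iff => {}x y; split=> [[]|[]].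
- by move=> psi phi x; apply: fsem_box_empty => {}x y [[-> _]].
- move=> t phi x /=; set R := clos_trans _ _.
  have Rtr x1 y1 z1 : R x1 y1 -> R y1 z1 -> R x1 z1 by apply: t_trans.
  have [H|] := classic (forall y, R x y -> ~ (forall z, R y z -> fsem M phi z) \/ fsem M phi y); last by left.
  right; suff: forall y, R x y -> fsem M phi y by [].
  (* The induction runs on [phi] relativised to the successors of [x], where the premise of the
     axiom is available. *)
  apply: (strict_loeb HM Rtr); first exact: (nid_plus_irrefl HM).
  move=> y IH xy; have [[]|//] := H y xy.
  by move=> z yz; apply: IH yz (Rtr _ _ _ xy yz).
Qed.

End Soundness.

(** * Propositional reasoning inside the Hilbert system *)

Section Calculus.
Variables A P : Type.
Implicit Types (phi psi chi : fm A P) (t u : tm A P).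

(* Treating boxes as opaque atoms reduces tautologies to truth tables. *)
Fixpoint skeleton phi : fm Empty_set (fm A P) :=
  match phi with
  | FImp psi chi => FImp (skeleton psi) (skeleton chi)
  | FFalse => FFalse
  | _ => FVar phi
  end.

Fixpoint eval (v : fm A P -> bool) phi : bool :=
  match phi with
  | FImp psi chi => eval v psi ==> eval v chi
  | FFalse => false
  | _ => v phi
  end.

(** The skeleton is a box-free PDL formula whose variables are themselves formulas; substituting by
    [id] recovers [phi], so [H_PDL] applies. *)
Lemma derivable_taut phi : (forall v, eval v phi) -> derivable phi.
Proof.
pose sa (a : Empty_set) : tm A P := match a with end.
have subst_sk chi : fsubst sa id (skeleton chi) = chi.
  by elim: chi => //= psi -> chi ->.
have pdl_sk chi : is_pdl_fm (skeleton chi).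
  by elim: chi => //=.
move=> H; rewrite -[phi]subst_sk; apply: H_PDL => // M _ x.
pose v chi : bool := if excluded_middle_informative (fval M chi x) then true else false.
have vP chi : fval M chi x <-> v chi.
  by rewrite /v; case: excluded_middle_informative.
have evP chi : fsem M (skeleton chi) x <-> eval v chi.
  elim: chi => //=.
  move=> psi IH1 chi IH2; rewrite IH1 IH2; case: (eval v psi); case: (eval v chi) => /=; intuition.
exact/evP.
Qed.

End Calculus.

Ltac taut :=
  apply: derivable_taut; let v := fresh "v" in move=> v; cbn;
  repeat match goal with
  | |- context [eval v ?x] => destruct (eval v x)
  | |- context [v ?x] => destruct (v x)
  end; reflexivity.
(* Adds a derived formula as a premise of the goal; premises accumulate until the goal is a
   tautology. *)
Tactic Notation "mp" uconstr(h) := refine (H_MP h _).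

(** * Derived laws for boxes, loops and strict parts *)

Section Modal.
Variables A P : Type.
Implicit Types (phi psi chi : fm A P) (t u : tm A P).

Definition pdl_sa (t u : tm A P) (b : bool) := if b then t else u.
Definition pdl_sp (phi psi : fm A P) (b : bool) := if b then phi else psi.

Lemma derivable_pdl (chi : fm bool bool) t u phi psi :
  is_pdl_fm chi -> valid_on (@REL _ _) chi ->
  derivable (fsubst (pdl_sa t u) (pdl_sp phi psi) chi).
Proof. exact: H_PDL. Qed.

Notation a := (@TVar bool bool true).
Notation b := (@TVar bool bool false).
Notation p := (@FVar bool bool true).
Notation q := (@FVar bool bool false).

Lemma box_K t phi psi :
  derivable (FImp (FBox t (FImp phi psi)) (FImp (FBox t phi) (FBox t psi))).
Proof.
apply: (@derivable_pdl
  (FImp (FBox a (FImp p q)) (FImp (FBox a p) (FBox a q))) t t phi psi) => //=.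
move=> M _ x; apply: fsem_imp => H; apply: fsem_imp => Hp y Hy.
by case: (H y Hy) => // nHp; case: nHp; apply: Hp.
Qed.

Lemma box_mono t phi psi :
  derivable (FImp phi psi) -> derivable (FImp (FBox t phi) (FBox t psi)).
Proof. by move=> h; mp (H_Nec t h); apply: box_K. Qed.

Lemma box_and t phi psi :
  derivable (FImp (FBox t phi) (FImp (FBox t psi) (FBox t (FAnd phi psi)))).
Proof.
mp (box_K t psi (FAnd phi psi)).
have h : derivable (FImp phi (FImp psi (FAnd phi psi))) by taut.
mp (box_mono t h); taut.
Qed.

Lemma box_seq t u phi :
  derivable (FIff (FBox (TSeq t u) phi) (FBox t (FBox u phi))).
Proof.
apply: (@derivable_pdl
  (FIff (FBox (TSeq a b) p) (FBox a (FBox b p))) t u phi phi) => //=.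
move=> M _ x; apply: fsem_iff; split=> H.
  by move=> y Hy z Hz; apply: H; exists y.
by move=> z [y [Hy Hz]]; apply: H Hy z Hz.
Qed.

Lemma box_sum t u phi :
  derivable (FIff (FBox (TSum t u) phi) (FAnd (FBox t phi) (FBox u phi))).
Proof.
apply: (@derivable_pdl
  (FIff (FBox (TSum a b) p) (FAnd (FBox a p) (FBox b p))) t u phi phi) => //=.
move=> M _ x; apply: fsem_iff; split=> H.
  by apply/fsem_and; split=> y Hy; apply: H; [left|right].
by move: H => /fsem_and [H1 H2] y [/H1|/H2].
Qed.

Lemma box_test psi phi :
  derivable (FIff (FBox (TTest psi) phi) (FImp psi phi)).
Proof.
apply: (@derivable_pdl
  (FIff (FBox (TTest q) p) (FImp q p)) (TTest psi) (TTest psi) phi psi) => //=.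
move=> M _ x; apply: fsem_iff; split=> H.
  by apply: fsem_imp => Hq; apply: H.
by move=> y [<- Hq]; case: H.
Qed.

Lemma box_plus t phi :
  derivable (FIff (FBox (TPlus t) phi)
                  (FAnd (FBox t phi) (FBox t (FBox (TPlus t) phi)))).
Proof.
apply: (@derivable_pdl
  (FIff (FBox (TPlus a) p) (FAnd (FBox a p) (FBox a (FBox (TPlus a) p))))
  t t phi phi) => //=.
move=> M _ x; apply: fsem_iff; split=> H.
  apply/fsem_and; split=> y Hy; first by apply: H; apply: t_step.
  by move=> z Hz; apply: H; apply: t_trans Hz; apply: t_step.
move: H => /fsem_and [H1 H2] y /= /clos_trans_t1n_iff h.
inversion h as [? h1|z ? h1 h2]; subst; first exact: H1.
by apply: (H2 z) => //; apply/clos_trans_t1n_iff.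
Qed.

Lemma box_plus_trans t phi :
  derivable (FImp (FBox (TPlus t) phi) (FBox (TPlus t) (FBox (TPlus t) phi))).
Proof.
apply: (@derivable_pdl
  (FImp (FBox (TPlus a) p) (FBox (TPlus a) (FBox (TPlus a) p)))
  t t phi phi) => //=.
move=> M _ x; apply: fsem_imp => H y Hy z Hz; apply: H.
exact: t_trans Hy Hz.
Qed.

(** Expresses that the current point is [t]-related to itself, which is all there is to know about
    the identity part of [t]. *)
Definition loops t : fm A P := FDia (TId t) FTrue.

Lemma box_id t phi : derivable (FIff (FBox (TId t) phi) (FImp (loops t) phi)).
Proof. by mp (H_id t phi); mp (box_test (loops t) phi); rewrite /loops; taut. Qed.

Lemma box_split t phi :
  derivable (FIff (FBox t phi) (FAnd (FImp (loops t) phi) (FBox (TNid t) phi))).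
Proof.
mp (H_split t phi); mp (box_sum (TId t) (TNid t) phi); mp (box_id t phi).
by rewrite /loops; taut.
Qed.

(** Since [loops t] negates the box of [TId t] at [FNot FTrue], this law and the ones after it come
    from box axioms taken at that formula. *)
Lemma loops_seq t u : derivable (FIff (loops (TSeq t u)) (FAnd (loops t) (loops u))).
Proof.
mp (H_id_seq t u (FNot FTrue)); mp (box_seq (TId t) (TId u) (FNot FTrue)).
mp (box_id t (FBox (TId u) (FNot FTrue))); mp (box_id u (FNot FTrue)).
by rewrite /loops; taut.
Qed.

Lemma loops_sum t u : derivable (FIff (loops (TSum t u)) (FOr (loops t) (loops u))).
Proof.
mp (H_id_sum t u (FNot FTrue)); mp (box_sum (TId t) (TId u) (FNot FTrue)).
by rewrite /loops; taut.
Qed.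

Lemma loops_plus t : derivable (FIff (loops (TPlus t)) (loops t)).
Proof. by mp (H_id_plus t (FNot FTrue)); rewrite /loops; taut. Qed.

Lemma loops_anti t :
  derivable (FIff (loops (TAnti t)) (FAnd (FNot (loops t)) (FBox (TNid t) FFalse))).
Proof.
mp (H_id_anti t (FNot FTrue)); mp (H_anti t (FNot FTrue)).
mp (box_test (FBox t FFalse) (FNot FTrue)); mp (box_split t FFalse).
by rewrite /loops; taut.
Qed.

Lemma loops_id t : derivable (FIff (loops (TId t)) (loops t)).
Proof. by mp (H_id_id t (FNot FTrue)); rewrite /loops; taut. Qed.

Lemma loops_nid t : derivable (FNot (loops (TNid t))).
Proof. by mp (H_id_nid t (FNot FTrue)); rewrite /loops; taut. Qed.

Lemma loops_test psi : derivable (FIff (loops (TTest psi)) psi).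
Proof.
mp (H_id_test psi (FNot FTrue)); mp (box_test psi (FNot FTrue)).
by rewrite /loops; taut.
Qed.

Lemma box_nid_seq t u phi :
  derivable (FIff (FBox (TNid (TSeq t u)) phi)
    (FAnd (FBox (TNid t) (FBox (TId u) phi))
      (FAnd (FImp (loops t) (FBox (TNid u) phi))
            (FBox (TNid t) (FBox (TNid u) phi))))).
Proof.
mp (H_nid_seq t u phi).
mp (box_sum (TSum (TSeq (TNid t) (TId u)) (TSeq (TId t) (TNid u)))
            (TSeq (TNid t) (TNid u)) phi).
mp (box_sum (TSeq (TNid t) (TId u)) (TSeq (TId t) (TNid u)) phi).
mp (box_seq (TNid t) (TId u) phi); mp (box_seq (TNid t) (TNid u) phi).
mp (box_seq (TId t) (TNid u) phi); mp (box_id t (FBox (TNid u) phi)).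
by rewrite /loops; taut.
Qed.

Lemma box_nid_sum t u phi :
  derivable (FIff (FBox (TNid (TSum t u)) phi)
                  (FAnd (FBox (TNid t) phi) (FBox (TNid u) phi))).
Proof. by mp (H_nid_sum t u phi); mp (box_sum (TNid t) (TNid u) phi); taut. Qed.

(** The axiom exchanges [TNid (TPlus t)] with [TPlus (TNid t)], for which [box_plus] is the fixpoint
    law; [box_mono] carries the exchange under the strict box. *)
Lemma box_nid_plus t phi :
  derivable (FIff (FBox (TNid (TPlus t)) phi)
    (FAnd (FBox (TNid t) phi) (FBox (TNid t) (FBox (TNid (TPlus t)) phi)))).
Proof.
have h := H_nid_plus t phi.
have h1 : derivable (FImp (FBox (TNid (TPlus t)) phi) (FBox (TPlus (TNid t)) phi)).
  by mp h; taut.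
have h2 : derivable (FImp (FBox (TPlus (TNid t)) phi) (FBox (TNid (TPlus t)) phi)).
  by mp h; taut.
mp (box_mono (TNid t) h1); mp (box_mono (TNid t) h2); mp h.
mp (box_plus (TNid t) phi).
by taut.
Qed.

End Modal.

(** * Atoms over a finite list of formulas, and the modality of later points *)

Section Literals.
Variables A P : Type.
Implicit Types (phi psi chi : fm A P) (t u : tm A P) (G : seq (fm A P)).

Fixpoint hat G (v : seq bool) : fm A P :=
  match G, v with
  | phi :: G', b :: v' => FAnd (if b then phi else FNot phi) (hat G' v')
  | _, _ => FTrue
  end.

Lemma hat_decides G v phi : List.In phi G -> size v = size G ->
  derivable (FImp (hat G v) phi) \/ derivable (FImp (hat G v) (FNot phi)).
Proof.
elim: G v => [//|psi G IH] [//|b v] /= [<- _|phi_in [sz]].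
  by case: b; [left|right]; taut.
by case: (IH v phi_in sz) => h; [left|right]; mp h; taut.
Qed.

(** Assignments differing only in the first literal combine to eliminate it. The general [B] covers
    both plain derivability and derivability of a box from a fixed premise. *)
Lemma hat_cases G (B : fm A P -> Prop) chi :
  (forall phi psi, derivable (FImp phi psi) -> B phi -> B psi) ->
  (forall phi psi, B phi -> B psi -> B (FAnd phi psi)) ->
  (forall v, size v = size G -> B (FImp (hat G v) chi)) -> B chi.
Proof.
move=> Bmono Band; elim: G chi => [|phi G IH] chi H.
  by apply: Bmono (H [::] erefl); taut.
apply: IH => v sz.
have H1 := H (true :: v) (congr1 S sz); have H2 := H (false :: v) (congr1 S sz).
by apply: Bmono (Band _ _ H1 H2) => /=; taut.
Qed.

(* Its iterated strict part reaches every strict successor relevant to [G]. *)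
Fixpoint master G : tm A P :=
  match G with
  | [::] => TTest FFalse
  | FBox (TNid t) _ :: G' => TSum t (master G')
  | _ :: G' => master G'
  end.

Lemma master_nid G t psi chi : List.In (FBox (TNid t) psi) G ->
  derivable (FImp (FBox (TNid (master G)) chi) (FBox (TNid t) chi)).
Proof.
elim: G => [//|phi G IH] /= [->|/IH {}IH].
  by mp (box_nid_sum t (master G) chi); taut.
case: phi => // u; case: u => // u _.
by mp (box_nid_sum u (master G) chi); mp IH; taut.
Qed.

(** A single modality for everything strictly later, in the shape required by the Löb axiom. *)
Definition later G phi : fm A P := FBox (TPlus (TNid (master G))) phi.

Lemma later_nid G t psi chi : List.In (FBox (TNid t) psi) G ->
  derivable (FImp (later G chi) (FBox (TNid t) (FAnd chi (later G chi)))).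
Proof.
move=> /master_nid h; mp (box_plus (TNid (master G)) chi).
mp (h chi); mp (h (later G chi)); mp (box_and (TNid t) chi (later G chi)).
by rewrite /later; taut.
Qed.

(** Löb read contrapositively: if every occurrence of [theta] is followed by another, [theta] is
    refutable. *)
Lemma later_loeb G theta : derivable (FImp (later G (FNot theta)) (FNot theta)) ->
  derivable (FNot theta).
Proof.
by move=> h; mp (H_MP (H_Nec _ h) (H_Loeb (master G) (FNot theta))).
Qed.

End Literals.

(** * The canonical model on a finite linear order *)

Section Canonical.
Variables (A P : Type) (G : seq (fm A P)).
Implicit Types (phi psi chi : fm A P) (t u : tm A P).
Let n := size G.

Definition state := ((n.-tuple bool) * {set n.-tuple bool})%type.
Implicit Types (s : state) (E : {set n.-tuple bool}).

Definition avoid E : fm A P :=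
  foldr (fun Z => FAnd (FNot (hat G (tval Z)))) FTrue (enum E).

Lemma avoidE E (Z : n.-tuple bool) : Z \in E ->
  derivable (FImp (avoid E) (FNot (hat G Z))).
Proof.
rewrite -mem_enum /avoid; elim: (enum E) => //= Z' l IH.
rewrite inE => /predU1P[<-|/IH h]; first by taut.
by mp h; taut.
Qed.

Lemma avoidI E chi :
  (forall Z : n.-tuple bool, Z \in E -> derivable (FImp chi (FNot (hat G Z)))) ->
  derivable (FImp chi (avoid E)).
Proof.
move=> H; have : forall Z : n.-tuple bool, Z \in enum E ->
  derivable (FImp chi (FNot (hat G Z))) by move=> Z; rewrite mem_enum; apply: H.
rewrite /avoid; elim: (enum E) => /= [|Z l IH] {}H; first by taut.
have h1 := H Z (mem_head _ _); mp h1.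
have h2 : derivable (FImp chi (foldr (fun Z => FAnd (FNot (hat G (tval Z)))) FTrue l)).
  by apply: IH => Z' Z'l; apply: H; rewrite inE Z'l orbT.
by mp h2; taut.
Qed.

(** The carrier contains all states; truth is controlled only at the consistent ones, which
    canonical steps never leave. *)
Definition cons s := ~ derivable (FNot (FAnd (hat G s.1) (later G (avoid s.2)))).
Definition holds s phi := derivable (FImp (hat G s.1) phi).

(** The usual canonical relation between atoms, restricted by growth of the excluded set, which
    makes it acyclic. *)
Definition nid_step (a : A) s s' :=
  [/\ cons s, cons s', s.2 \proper s'.2 &
      ~ derivable (FImp (hat G s.1) (FBox (TNid (TVar a)) (FNot (hat G s'.1))))].

(** Lexicographic code: the size of the excluded set comes first, and the rank, being smaller than
    the number of states, breaks ties. *)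
Definition key s : nat := #|s.2| * #|{: state}| + enum_rank s.

Lemma key_inj : injective key.
Proof.
move=> s s'; rewrite /key => e.
have h : enum_rank s = enum_rank s'.
  apply: val_inj => /=; move: e (ltn_ord (enum_rank s)) (ltn_ord (enum_rank s')).
  move=> /(congr1 (modn^~ #|{: state}|)); rewrite !modnMDl => e l l'.
  by rewrite !modn_small in e.
exact: enum_rank_inj h.
Qed.

Lemma key_proper s s' : s.2 \proper s'.2 -> key s <= key s'.
Proof.
move=> /proper_card h; rewrite /key.
apply: (@leq_trans (#|s.2|.+1 * #|{: state}|)).
  by rewrite mulSn addnC leq_add2r ltnW.
by apply: leq_trans (leq_addr _ _); rewrite leq_mul2r h orbT.
Qed.

Definition can_univ : relation state := fun s s' => key s <= key s'.
Definition can_tval (a : A) : relation state := fun s s' =>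
  (s = s' /\ holds s (loops (TVar a))) \/ nid_step a s s'.

Lemma can_tval_univ a : inclusion state (can_tval a) can_univ.
Proof. by move=> s s' [[-> _]|[_ _ /key_proper]] //; rewrite /can_univ. Qed.

Definition canonical : gstruct A P :=
  @GStruct A P state (inhabits ([tuple of nseq n true], set0)) can_univ can_tval
    can_tval_univ (fun p s => holds s (FVar p)).

Lemma canonical_finlin : GREL_finlin canonical.
Proof.
split; last split.
- exists (enum {: state}) => s; have := mem_enum {: state} s.
  elim: (enum _) => //= s' l IH; rewrite !inE in IH *.
  by case/predU1P => [->|h]; [left|right; apply: IH].
- split=> [s|s1 s2 s3|s1 s2] /=; rewrite /can_univ //; first exact: leq_trans.
  by move=> h1 h2; apply: key_inj; apply/eqP; rewrite eqn_leq h1 h2.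
- by move=> s s' /=; apply/orP; apply: leq_total.
Qed.

Notation decided phi := (List.In phi G).

Lemma holds_mp s phi psi : derivable (FImp phi psi) -> holds s phi -> holds s psi.
Proof. by move=> h1 h2; mp h1; mp h2; taut. Qed.

Lemma holds_thm s phi : derivable phi -> holds s phi.
Proof. by move=> h; mp h; taut. Qed.

Lemma holds_and s phi psi : holds s (FAnd phi psi) <-> holds s phi /\ holds s psi.
Proof.
split=> [h|[h1 h2]]; last by mp h1; mp h2; taut.
by split; mp h; taut.
Qed.

Lemma holds_iff s phi psi : derivable (FIff phi psi) -> holds s phi <-> holds s psi.
Proof. by move=> h; split=> h1; mp h; mp h1; taut. Qed.

Lemma holds_imp s phi psi : decided phi ->
  holds s (FImp phi psi) <-> (holds s phi -> holds s psi).
Proof.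
move=> d; split=> [h1 h2|h]; first by mp h1; mp h2; taut.
case: (hat_decides d (size_tuple s.1)) => h1.
  by mp (h h1); taut.
by mp h1; taut.
Qed.

Lemma cons_false s phi : cons s -> holds s phi -> ~ holds s (FNot phi).
Proof. by move=> c h1 h2; apply: c; mp h1; mp h2; taut. Qed.

Lemma holds_not s phi : cons s -> decided phi -> holds s (FNot phi) <-> ~ holds s phi.
Proof.
move=> c d; split=> [h1 h2|nh]; first exact: cons_false c h2 h1.
by case: (hat_decides d (size_tuple s.1)).
Qed.

Lemma holds_or s phi psi : cons s -> decided phi ->
  holds s (FOr phi psi) <-> holds s phi \/ holds s psi.
Proof.
move=> c d; split=> [h|]; last by case=> h; mp h; taut.
case: (hat_decides d (size_tuple s.1)) => h1; [by left|right].
by mp h1; mp h; taut.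
Qed.

(** Otherwise the atom of [s'] refutes [psi], so the box of [psi] would imply the box of the negated
    atom, which the step rules out. *)
Lemma nid_step_box a s s' psi : decided psi ->
  nid_step a s s' -> holds s (FBox (TNid (TVar a)) psi) -> holds s' psi.
Proof.
move=> d [_ _ _ nh] h; case: (hat_decides d (size_tuple s'.1)) => // h'.
case: nh; apply: holds_mp h; apply: box_mono; by mp h'; taut.
Qed.

Lemma later_mono phi psi : derivable (FImp phi psi) ->
  derivable (FImp (later G phi) (later G psi)).
Proof. exact: box_mono. Qed.

(* Passing to a successor outside the excluded set, Löb lets us pick it so
   that it never recurs later; it can then be excluded in turn. *)
Lemma nid_step_dia a s psi : cons s -> decided (FBox (TNid (TVar a)) psi) ->
  ~ holds s (FBox (TNid (TVar a)) psi) ->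
  exists s', nid_step a s s' /\ ~ holds s' psi.
Proof.
case: s => X E /= c d nh; set t := TNid (TVar a) in d nh *.
have {nh} hn : derivable (FImp (hat G X) (FNot (FBox t psi))).
  by case: (hat_decides d (size_tuple X)).
pose N := avoid E; pose K := FAnd (hat G X) (later G N).
(* What the successor must satisfy: refute [psi], and avoid [E] both there and later. *)
pose g := FAnd (FNot psi) (FAnd N (later G N)).
pose B chi := derivable (FImp K (FBox t chi)).
have Bmono f1 f2 : derivable (FImp f1 f2) -> B f1 -> B f2.
  by move=> h1 h2; mp (box_mono t h1); mp h2; taut.
have Bthm f : derivable f -> B f by move=> h; mp (H_Nec t h); taut.
have Band f1 f2 : B f1 -> B f2 -> B (FAnd f1 f2).
  by move=> h1 h2; mp h1; mp h2; mp (box_and t f1 f2); taut.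
have nB : ~ B (FNot g).
  move=> h; apply: c => /=.
  have h1 : derivable (FImp (later G N) (FBox t (FAnd N (later G N)))) by apply: later_nid d.
  have h2 : derivable (FImp (FNot g) (FImp (FAnd N (later G N)) psi)) by taut.
  mp (box_mono t h2); mp (box_K t (FAnd N (later G N)) psi).
  by mp h; mp h1; mp hn; rewrite /K -/N; taut.
(* [B] respects implication and conjunction, so the failure of [B (FNot g)] localises to one
   assignment [Y]. *)
have [Y [szY nBY]] : exists v, size v = n /\ ~ B (FImp (hat G v) (FNot g)).
  apply: NNPP => H; apply: nB; apply: (@hat_cases _ _ G) => // v sz.
  by apply: NNPP => nBv; apply: H; exists v.
pose Z : n.-tuple bool := tcast szY (in_tuple Y).
have eZ : tval Z = Y by rewrite val_tcast.
have YE : Z \notin E.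
  apply/negP => /avoidE; rewrite eZ -/N => h; apply: nBY; apply: Bthm.
  by mp h; rewrite /g; taut.
exists (Z, Z |: E); split; first split => //=; rewrite ?eZ.
- rewrite /cons /= eZ => h.
  apply: nBY; apply: Bthm.
  have hN : derivable (FImp (FAnd (FNot (hat G Y)) N) (avoid (Z |: E))).
    apply: avoidI => Z'; rewrite !inE => /predU1P[->|/avoidE h1].
      by rewrite eZ; taut.
    by mp h1; rewrite -/N; taut.
  (* [h] says that [Y] cannot occur for the last time while [E] is avoided later. So each point of
     [theta] has a later one, and Löb refutes [theta], contradicting the choice of [Y]. *)
  pose theta := FAnd (hat G Y) (later G N).
  suff h1 : derivable (FNot theta) by mp h1; rewrite /theta /g; taut.
  apply: (@later_loeb _ _ G).
  have h2 : derivable (FImp (FAnd (FNot theta) (FAnd N (later G N))) (avoid (Z |: E))).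
    by mp hN; rewrite /theta; taut.
  mp (later_mono h2); mp h.
  mp (box_and (TPlus (TNid (master G))) (FNot theta) (FAnd N (later G N))).
  mp (box_and (TPlus (TNid (master G))) N (later G N)).
  mp (box_plus_trans (TNid (master G)) N).
  by rewrite /theta /later; taut.
- by apply/properP; split; [exact: subsetUr|exists Z; rewrite ?setU11].
- rewrite -/t => h; apply: nBY; apply: (@Bmono (FNot (hat G Y))).
    by rewrite /g; taut.
  by rewrite /B; mp h; rewrite /K; taut.
- rewrite /holds /= eZ => h; apply: nBY; apply: Bthm.
  by mp h; rewrite /g; taut.
Qed.

End Canonical.

(** * The closure set of a formula *)

Section Closure.
Variables A P : Type.

(** Follows the unfolding laws for strict boxes. For [TPlus u] the box itself returns as a
    continuation of the smaller term [u], so the closure stays finite. *)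
Fixpoint clos_nid (t : tm A P) (psi : fm A P) {struct t} : seq (fm A P) :=
  psi :: FBox (TNid t) psi ::
  match t with
  | TSeq u v =>
      clos_nid u (FBox (TId v) psi) ++ clos_nid u (FBox (TNid v) psi) ++
      clos_nid v psi
  | TSum u v => clos_nid u psi ++ clos_nid v psi
  | TPlus u => clos_nid u psi ++ clos_nid u (FBox (TNid (TPlus u)) psi)
  | TNid u => clos_nid u psi
  | _ => [::]
  end.

Fixpoint clos_fm (phi : fm A P) : seq (fm A P) :=
  phi :: match phi with
  | FImp psi chi => clos_fm psi ++ clos_fm chi
  | FBox t psi => clos_tm t ++ clos_nid t psi ++ clos_fm psi
  | _ => [::]
  end
with clos_tm (t : tm A P) : seq (fm A P) :=
  loops t :: match t with
  | TVar _ => [::]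
  | TSeq u v | TSum u v => clos_tm u ++ clos_tm v
  | TPlus u | TId u | TNid u => clos_tm u
  | TAnti u => clos_tm u ++ clos_nid u FFalse
  | TTest phi => clos_fm phi
  end.

End Closure.

Lemma Forall_cat T (Q : T -> Prop) (l1 l2 : seq T) :
  List.Forall Q (l1 ++ l2) <-> List.Forall Q l1 /\ List.Forall Q l2.
Proof. exact: List.Forall_app. Qed.

(** * The truth lemma *)

Section Truth.
Variables (A P : Type) (G : seq (fm A P)).
Implicit Types (phi psi chi : fm A P) (t u : tm A P).
Let M := canonical G.
Implicit Types (s : state G).
Notation closed := (List.Forall (fun phi => List.In phi G)).

(** Proper inclusion composes along sequences and iterations; this preserves consistency and bounds
    the number of strict steps. *)
Lemma canonical_step t s s' : tsem M t s s' ->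
  s = s' \/ cons s' /\ s.2 \proper s'.2.
Proof.
elim: t s s' => /=.
- by move=> a s s' [[e _]|[_ c h _]]; [left|right].
- move=> t IHt u IHu s s' [z [/IHt [<-|[c h]] /IHu [<-|[c' h']]]]; try by [left|right].
  by right; split=> //; apply: proper_trans h'.
- by move=> t IHt u IHu s s' [/IHt|/IHu].
- move=> t IHt s s'; elim=> [? ? /IHt //|s1 z s2 _ [->//|[c h]] _ [<-|[c' h']]].
    by right.
  by right; split=> //; apply: proper_trans h'.
- by move=> t _ s s' [e _]; left.
- by move=> t IHt s s' [/IHt].
- by move=> t IHt s s' [/IHt].
- by move=> phi s s' [e _]; left.
Qed.

Lemma canonical_cons t s s' : cons s -> tsem M t s s' -> cons s'.
Proof. by move=> c /canonical_step [<-|[]]. Qed.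

Definition truth_loops t := forall s, cons s -> (tsem M t s s <-> holds s (loops t)).
(** Stated with [holds] at the target rather than [fsem], because the continuation [psi] may be a
    box larger than any formula covered by the induction. *)
Definition truth_box t psi := forall s s', cons s -> s <> s' -> tsem M t s s' ->
  holds s (FBox (TNid t) psi) -> holds s' psi.
Definition truth_dia t psi := forall s, cons s -> ~ holds s (FBox (TNid t) psi) ->
  exists s', [/\ s <> s', tsem M t s s' & ~ holds s' psi].
Definition truth_nid t := forall psi, closed (clos_nid t psi) ->
  truth_box t psi /\ truth_dia t psi.
Definition truth_tm t := closed (clos_tm t) -> truth_loops t /\ truth_nid t.
Definition truth_fm phi := closed (clos_fm phi) ->
  forall s, cons s -> (fsem M phi s <-> holds s phi).

Lemma clos_tm_loops t : closed (clos_tm t) -> List.In (loops t) G.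
Proof. by case: t => [?|? ?|? ?|?|?|?|?|?] /List.Forall_cons_iff []. Qed.

Lemma clos_fm_self phi : closed (clos_fm phi) -> List.In phi G.
Proof. by case: phi => [?|? ?||? ?] /List.Forall_cons_iff []. Qed.

Lemma clos_nid_self t psi : closed (clos_nid t psi) ->
  List.In psi G /\ List.In (FBox (TNid t) psi) G.
Proof. by case: t => [?|? ?|? ?|?|?|?|?|?] /List.Forall_cons_iff [? /List.Forall_cons_iff []]. Qed.

(** Covers antidomains, identity parts and tests, whose strict part is empty. *)
Lemma truth_nid_trivial t :
  (forall s s', tsem M t s s' -> s = s') ->
  (forall psi, derivable (FBox (TNid t) psi)) -> truth_nid t.
Proof.
move=> H1 H2 psi _; split=> [s s' _ n /H1 //|s _ []].
exact: holds_thm.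
Qed.

Lemma nid_step_neq a s s' : nid_step a s s' -> s <> s'.
Proof. by move=> h e; subst s'; case: h => _ _; rewrite properxx. Qed.

Lemma truth_var a : truth_tm (TVar a).
Proof.
move=> _; split=> [s c|psi].
  by split=> [[[_ //]|/nid_step_neq []//]|h]; left.
move=> /clos_nid_self [d d']; split=> [s s' c n [[//]|h]|s c nh].
  exact: nid_step_box h.
have [s' [h h']] := nid_step_dia c d' nh.
by exists s'; split=> //; [apply: nid_step_neq h|right].
Qed.

Lemma truth_seq t u : truth_tm t -> truth_tm u -> truth_tm (TSeq t u).
Proof.
move=> IHt IHu /List.Forall_cons_iff [_ /Forall_cat [ct cu]].
have dt := clos_tm_loops ct; have du := clos_tm_loops cu.
have [lt nt] := IHt ct; have [lu nu] := IHu cu; split=> [s c|psi].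
  rewrite (holds_iff _ (loops_seq t u)) holds_and -lt // -lu //.
  split=> [[z [h1 h2]]|[h1 h2]]; last by exists s.
  by have e := tsem_seq_id (canonical_finlin G) h1 h2; subst z.
move=> /List.Forall_cons_iff [_ /List.Forall_cons_iff [_ /Forall_cat [c1 /Forall_cat [c2 c3]]]].
have [bt1 dt1] := nt _ c1; have [bt2 dt2] := nt _ c2; have [bu1 du1] := nu _ c3.
have hid s : holds s (FBox (TId u) psi) <-> (holds s (loops u) -> holds s psi).
  by rewrite (holds_iff _ (box_id u psi)) holds_imp.
split=> [s s' c n [z [h1 h2]]|s c].
  rewrite (holds_iff _ (box_nid_seq t u psi)) !holds_and holds_imp //.
  move=> [g1 [g2 g3]]; have cz := canonical_cons c h1.
  have [e|n1] := classic (s = z).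
    by subst z; apply: bu1 n h2 (g2 _) => //; apply/lt.
  have [e|n2] := classic (z = s').
    by subst z; have /hid := bt1 _ _ c n h1 g1; apply; apply/lu.
  by apply: bu1 n2 h2 _ => //; apply: bt2 h1 g3.
rewrite (holds_iff _ (box_nid_seq t u psi)) !holds_and holds_imp //.
(* The failing conjunct tells which factor moves strictly: only [t], only [u], or both. *)
move=> /not_and_or [/dt1|/not_and_or [g|/dt2]].
- move=> /(_ c) [z [n h1]]; rewrite hid => g.
  have [g1 g2] := imply_to_and _ _ g.
  exists z; split=> //; exists z; split=> //.
  by apply/lu => //; apply: canonical_cons h1.
- have [g1 /(du1 _ c) [s' [n h1 h2]]] := imply_to_and _ _ g.
  by exists s'; split=> //; exists s; split=> //; apply/lt.
- move=> /(_ c) [z [n h1]] /(du1 _ (canonical_cons c h1)) [s' [n' h2 h3]].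
  exists s'; split=> //; last by exists z.
  by move=> e; subst s'; apply: n; rewrite (tsem_seq_id (canonical_finlin G) h1 h2).
Qed.

Lemma truth_sum t u : truth_tm t -> truth_tm u -> truth_tm (TSum t u).
Proof.
move=> IHt IHu /List.Forall_cons_iff [_ /Forall_cat [ct cu]].
have dt := clos_tm_loops ct.
have [lt nt] := IHt ct; have [lu nu] := IHu cu; split=> [s c|psi].
  by rewrite (holds_iff _ (loops_sum t u)) holds_or // -lt // -lu.
move=> /List.Forall_cons_iff [_ /List.Forall_cons_iff [_ /Forall_cat [c1 c2]]].
have [bt dt1] := nt _ c1; have [bu du] := nu _ c2.
split=> [s s' c n h|s c]; rewrite (holds_iff _ (box_nid_sum t u psi)) holds_and.
  by case: h => h [g1 g2]; [apply: bt h g1|apply: bu h g2].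
move=> /not_and_or [/(dt1 _ c)|/(du _ c)] [s' [n h g]]; exists s'; split=> //.
  by left.
by right.
Qed.

Lemma truth_plus t : truth_tm t -> truth_tm (TPlus t).
Proof.
move=> IHt /List.Forall_cons_iff [_ ct]; have [lt nt] := IHt ct; split=> [s c|psi].
  rewrite (holds_iff _ (loops_plus t)) -lt //; split=> [h|h]; last exact: t_step.
  exact: (tsem_plus_id (canonical_finlin G) h).
move=> /List.Forall_cons_iff [_ /List.Forall_cons_iff [_ /Forall_cat [c1 c2]]].
have [b1 d1] := nt _ c1; have [b2 d2] := nt _ c2.
have unfold s := holds_iff s (box_nid_plus t psi).
split.
  move=> s s' c n h g.
  suff: s = s' \/ holds s' psi by case.
  have {n}h : clos_trans_1n _ (tsem M t) s s' by apply/clos_trans_t1n_iff.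
  elim: h c g => [{}s {}s' h c /unfold/holds_and [g _]|{}s z {}s' h _ IH c g].
    have [|n] := classic (s = s'); first by left.
    by right; apply: b1 h g.
  have [e|n] := classic (s = z); first by subst z; apply: IH.
  have /holds_and [g1 g2] := (unfold s).1 g.
  case: (IH (canonical_cons c h) (b2 _ _ c n h g2)) => [e|]; last by right.
  by subst s'; right; apply: b1 h g1.
(* Each strict step shrinks the complement of the excluded set, so repeated unfolding of the refuted
   box terminates in a witness. *)
move=> s; have [k] := ubnP #|~: s.2|; elim: k s => // k IH s lek c.
rewrite unfold holds_and => /not_and_or [/(d1 _ c)|/(d2 _ c)] [z [n h g]].
  by exists z; split=> //; apply: t_step.
have [//|[cz lt_z]] := canonical_step h.
have [|s' [n' h' g']] := IH z _ cz g.
  by apply: (@leq_trans #|~: s.2|); [rewrite proper_card // properC|].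
have h2 : tsem M (TPlus t) s z by apply: t_step.
exists s'; split=> //; last exact: t_trans h2 h'.
by move=> e; subst s'; apply: n; rewrite (tsem_seq_id (canonical_finlin G) h2 h').
Qed.

Lemma truth_anti t : truth_tm t -> truth_tm (TAnti t).
Proof.
move=> IHt /List.Forall_cons_iff [_ /Forall_cat [ct cn]].
have [lt nt] := IHt ct; have [b d] := nt _ cn; split=> [s c|].
  rewrite (holds_iff _ (loops_anti t)) holds_and holds_not ?(clos_tm_loops ct) //; last exact: clos_tm_loops.
  rewrite -lt //; split=> [[_ h]|[h1 h2]].
    split=> [hs|]; first by apply: h; exists s.
    by apply: NNPP => /(d _ c) [s' [_ h' _]]; apply: h; exists s'.
  split=> // -[z h]; have [e|n] := classic (s = z); first by subst z.
  have cz := canonical_cons c h.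
  apply: (cons_false cz (b _ _ c n h h2)).
  by apply: holds_thm; taut.
apply: truth_nid_trivial => [s s' []//|psi].
by mp (H_nid_anti t psi); taut.
Qed.

Lemma truth_id t : truth_tm t -> truth_tm (TId t).
Proof.
move=> IHt /List.Forall_cons_iff [_ ct]; have [lt nt] := IHt ct; split=> [s c|].
  by rewrite (holds_iff _ (loops_id t)) -lt //; split=> [[]|].
apply: truth_nid_trivial => [s s' []//|psi].
by mp (H_nid_id t psi); taut.
Qed.

Lemma truth_tnid t : truth_tm t -> truth_tm (TNid t).
Proof.
move=> IHt /List.Forall_cons_iff [_ ct]; have [lt nt] := IHt ct; split=> [s c|psi].
  split=> [[_ []//]|h].
  by case: (cons_false c h); apply: holds_thm; apply: loops_nid.
move=> /List.Forall_cons_iff [_ /List.Forall_cons_iff [_ cn]]; have [b d] := nt _ cn.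
split=> [s s' c n [h _]|s c]; rewrite (holds_iff _ (H_nid_nid t psi)).
  exact: b h.
by move=> /(d _ c) [s' [n h g]]; exists s'.
Qed.

Lemma truth_test phi : truth_fm phi -> truth_tm (TTest phi).
Proof.
move=> IH /List.Forall_cons_iff [_ cf]; split=> [s c|].
  rewrite (holds_iff _ (loops_test phi)) -IH //.
  by split=> [[]|].
apply: truth_nid_trivial => [s s' []//|psi].
by mp (H_nid_test phi psi); taut.
Qed.

Lemma truth_imp phi psi : truth_fm phi -> truth_fm psi -> truth_fm (FImp phi psi).
Proof.
move=> IH1 IH2 /List.Forall_cons_iff [_ /Forall_cat [c1 c2]] s c.
rewrite holds_imp; last exact: clos_fm_self.
by rewrite -IH1 // -IH2 //=; tauto.
Qed.

Lemma truth_false : truth_fm FFalse.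
Proof.
move=> _ s c; split=> // h; apply: (cons_false c h).
by apply: holds_thm; taut.
Qed.

Lemma truth_fbox t psi : truth_tm t -> truth_fm psi -> truth_fm (FBox t psi).
Proof.
move=> IHt IH /List.Forall_cons_iff [_ /Forall_cat [ct /Forall_cat [cn cf]]] s c.
have [lt nt] := IHt ct; have [b d] := nt _ cn.
rewrite (holds_iff _ (box_split t psi)) holds_and holds_imp; last exact: clos_tm_loops.
split=> [h|[h1 h2] y h].
  split=> [/(lt _ c) /h /(IH cf _ c) //|].
  apply: NNPP => /(d _ c) [s' [_ h1 []]].
  by apply/IH => //; [apply: canonical_cons h1|apply: h].
apply/IH => //; first exact: canonical_cons h.
have [e|n] := classic (s = y); last exact: b h h2.
by subst y; apply: h1; apply/lt.
Qed.

Lemma truth : (forall phi, truth_fm phi) /\ (forall t, truth_tm t).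
Proof.
apply: fm_tm_mutind.
- by move=> p _ s _.
- by move=> f ? g ?; apply: truth_imp.
- exact: truth_false.
- by move=> t ? psi ?; apply: truth_fbox.
- exact: truth_var.
- by move=> t ? u ?; apply: truth_seq.
- by move=> t ? u ?; apply: truth_sum.
- exact: truth_plus.
- exact: truth_anti.
- exact: truth_id.
- exact: truth_tnid.
- exact: truth_test.
Qed.

End Truth.

(** * From the truth lemma to completeness *)

Lemma completeness (A P : Type) (phi : fm A P) :
  valid_on (@GREL_finlin A P) phi -> derivable phi.
Proof.
move=> V; pose G := clos_fm phi.
apply: (@hat_cases _ _ G) => [f g h1 h2|f g h1 h2|v sz].
- by mp h2.
- by mp h1; mp h2; taut.
(* Nothing is excluded at the start, so this state is inconsistent only if the atom alone is
   refutable. *)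
pose s : state G := (tcast sz (in_tuple v), set0).
have es : hat G s.1 = hat G v by rewrite /s /= val_tcast.
have [c|nc] := classic (cons s).
  have cG : List.Forall (fun psi => List.In psi G) G by apply/List.Forall_forall.
  have /((truth G).1 phi cG s c) := V _ (canonical_finlin G) s.
  by rewrite /holds es.
have h := NNPP _ nc; rewrite es /= in h.
(* Avoiding the empty set is a theorem, now and later, so inconsistency of [s] refutes the atom and
   [phi] follows from it vacuously. *)
have h0 : derivable (FImp FTrue (@avoid _ _ G set0)) by apply: avoidI => Z; rewrite inE.
have h1 : derivable (@avoid _ _ G set0) by mp h0; taut.
have h2 : derivable (later G (@avoid _ _ G set0)) := H_Nec _ h1.
by mp h; mp h2; taut.
Qed.

Theorem theorem1 (A P : Type) (phi : fm A P) :
  valid_on (@GREL_finlin A P) phi <-> derivable phi.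
Proof. by split; [exact: completeness|exact: soundness]. Qed.
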